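(* Let $\mathfrak{B}$ be a bornology on a metric space $X$ with a compact base $\mathfrak{B}_0$ and let $\mathcal{I},\mathcal{J}$ be ideals on $\omega$. Let $Y$ be a metric space and $f:X\to Y$ a continuous function. The following statements hold. (1) If $X$ satisfies $\mathrm{S}_1(\mathcal{I}\text{-}\Gamma_{\mathfrak{B}^s},\mathcal{J}\text{-}\Gamma_{\mathfrak{B}^s})$, then $f(X)$ satisfies $\mathrm{S}_1(\mathcal{I}\text{-}\Gamma_{f(\mathfrak{B})^s},\mathcal{J}\text{-}\Gamma_{f(\mathfrak{B})^s})$. (2) If $X$ satisfies $\mathrm{S}_1(\mathcal{O}_{\mathfrak{B}^s},\mathcal{J}\text{-}\Gamma_{\mathfrak{B}^s})$, then $f(X)$ satisfies $\mathrm{S}_1(\mathcal{O}_{f(\mathfrak{B})^s},\mathcal{J}\text{-}\Gamma_{f(\mathfrak{B})^s})$.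
   Context: $X$ is an infinite metric space; $\omega$ is the set of natural numbers. A bornology $\mathfrak{B}$ on a metric space $(Z,d)$ is a family of subsets of $Z$ that is closed under subsets and finite unions and covers $Z$. A base of $\mathfrak{B}$ is a subfamily $\mathfrak{B}_0\subseteq\mathfrak{B}$ such that every $B\in\mathfrak{B}$ is contained in some $B_0\in\mathfrak{B}_0$; it is a compact base if its members are compact. For $B\in\mathfrak{B}$, $\delta>0$: $B^\delta=\bigcup_{x\in B}\{y\in Z:d(x,y)<\delta\}$. For $f:X\to Y$, $f(\mathfrak{B})=\{f(B):B\in\mathfrak{B}\}$, a bornology on the metric subspace $f(X)$ of $Y$. An ideal on $\omega$ is a family $\mathcal{I}\subseteq\mathcal{P}(\omega)$ closed under subsets and finite unions, containing all finite sets, with $\omega\notin\mathcal{I}$. For a space $Z$ with bornology $\mathfrak{B}$: covers of $Z$ never contain $Z$ as an element. A cover $\mathcal{U}$ of $Z$ by open sets is an open $\mathfrak{B}^s$-cover if for each $B\in\mathfrak{B}$ there are $U\in\mathcal{U}$ and $\delta>0$ with $B^\delta\subseteq U$; $\mathcal{O}_{\mathfrak{B}^s}$ is the class of these. A countable open cover $\{U_n:n\in\omega\}$ (with its enumeration) is an $\mathcal{I}$-$\gamma_{\mathfrak{B}^s}$-cover if for each $B\in\mathfrak{B}$ there is a sequence $\{\delta_n\}$ of positive reals with $\{n\in\omega:B^{\delta_n}\nsubseteq U_n\}\in\mathcal{I}$; $\mathcal{I}\text{-}\Gamma_{\mathfrak{B}^s}$ is the class of these. The classes $\mathcal{O}_{f(\mathfrak{B})^s}$,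 $\mathcal{I}\text{-}\Gamma_{f(\mathfrak{B})^s}$ are those for the space $f(X)$ with bornology $f(\mathfrak{B})$. $\mathrm{S}_1(\mathcal{A},\mathcal{B})$: for every sequence $\{A_n:n\in\omega\}$ of elements of $\mathcal{A}$ there are $a_n\in A_n$ ($n\in\omega$) such that $\{a_n:n\in\omega\}\in\mathcal{B}$ (for enumerated covers, with the enumeration $n\mapsto a_n$). *)

(* Defs.v *)
From HB Require Import structures.
From mathcomp Require Import all_boot all_order all_algebra.
From mathcomp Require Import all_classical all_reals all_analysis.

Set Implicit Arguments.
Unset Strict Implicit.
Unset Printing Implicit Defensive.

Import Order.TTheory GRing.Theory Num.Theory.

Local Open Scope classical_set_scope.
Local Open Scope ring_scope.

(* The library equips the subtype [set_type A] with the pseudometric induced by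
   the inclusion [set_val]; when the ambient space is a metric space, so is
   [set_type A], with the restricted distance. *)
Section subtype_metric.
Context {R : realType} {Y : metricType R} (A : set Y).

Let sub_dist (x y : A) : R := mdist (set_val x) (set_val y).

Let sub_dist_ge0 x y : 0 <= sub_dist x y.
Proof. exact: mdist_ge0. Qed.

Let sub_dist_positivity x y : sub_dist x y = 0 -> x = y.
Proof. by move=> /mdist_positivity /val_inj. Qed.

Let sub_ballE (x : A) d : ball x d = [set y | sub_dist x y < d].
Proof.
rewrite -[LHS]/(set_val @^-1` ball (set_val x) d).
by rewrite ballEmdist.
Qed.

HB.instance Definition _ := @PseudoMetric_isMetric.Build R (A : Type)
  sub_dist sub_dist_ge0 sub_dist_positivity sub_ballE.

End subtype_metric.

Definition is_ideal (I : set (set nat)) : Prop :=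
  [/\ forall A B, A `<=` B -> I B -> I A,
      forall A B, I A -> I B -> I (A `|` B),
      forall A, finite_set A -> I A
    & ~ I [set: nat]].

Definition is_bornology {Z : Type} (BB : set (set Z)) : Prop :=
  [/\ forall A B, A `<=` B -> BB B -> BB A,
      forall A B, BB A -> BB B -> BB (A `|` B)
    & \bigcup_(B in BB) B = [set: Z]].

Definition is_compact_base {Z : topologicalType} (BB BB0 : set (set Z)) : Prop :=
  [/\ BB0 `<=` BB,
      forall B, BB B -> exists2 B0, BB0 B0 & B `<=` B0
    & forall B0, BB0 B0 -> compact B0].

(* [f(B)] is a subset of [Y]; its preimage by [set_val] is the same set seen as
   a subset of the metric subspace [f(X)]. *)
Definition image_bornology {X Y : Type} (f : X -> Y) (BB : set (set X)) :
    set (set (range f)) :=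
  [set set_val @^-1` (f @` B) | B in BB].
Arguments image_bornology {X Y} f BB.

Section covers.
Context {R : realType} {Z : metricType R}.
Implicit Types (BB : set (set Z)) (I : set (set nat)).

Definition enlargement (B : set Z) (delta : R) : set Z :=
  \bigcup_(x in B) [set y | mdist x y < delta].

Definition open_cover (UU : set (set Z)) : Prop :=
  [/\ forall U, UU U -> open U,
      \bigcup_(U in UU) U = [set: Z]
    & ~ UU [set: Z]].

Definition open_Bs_covers BB : set (set (set Z)) :=
  [set UU | open_cover UU /\
    forall B, BB B ->
      exists U delta, [/\ UU U, 0 < delta & enlargement B delta `<=` U]].

Definition gamma_Bs_covers I BB : set (nat -> set Z) :=
  [set U | open_cover (range U) /\
    forall B, BB B ->
      exists delta : nat -> R, (forall n, 0 < delta n) /\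
        I [set n | ~ (enlargement B (delta n) `<=` U n)]].

End covers.

(* Enumerated covers, seen as families of sets. *)
Definition families {Z : Type} (C : set (nat -> set Z)) : set (set (set Z)) :=
  [set range U | U in C].

(* The selected sets form an enumerated cover [n |-> a n], so the second class
   is a class of sequences; the first one is a class of families. *)
Definition S1 {Z : Type} (A : set (set (set Z))) (B : set (nat -> set Z)) : Prop :=
  forall UU : nat -> set (set Z), (forall n, A (UU n)) ->
    exists a : nat -> set Z, (forall n, UU n (a n)) /\ B a.

(* Main.v *)
Require Import Defs.
From mathcomp Require Import all_boot all_order all_algebra.
From mathcomp Require Import all_classical all_reals all_analysis.

Import Order.TTheory GRing.Theory Num.Theory.

Local Open Scope classical_set_scope.

(** In a metric space, a compact set contained in an open set still has a whole
enlargement in it ([compact_enlargement_subset]).  Hence, for a bornology with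
a compact base, the enlargements can be erased from the definitions of the two
classes of covers: [B^delta] included in [U] for some [delta] may be replaced
by plain inclusion of [B] in [U] ([open_Bs_coversP], [gamma_Bs_coversP]).

The continuous map [f], seen as a surjection [g] onto the metric subspace
[f(X)], carries a compact base of [BB] to a compact base of [f(BB)], so the
simplification is available on both sides.  Inclusion, unlike enlargement, is
transported exactly by [g]: [g(B)] is included in [U] if and only if [B] is
included in the preimage of [U].  Selection principles therefore pass from [X]
to [f(X)] ([S1_surjection]): pull the given covers back along [g], select in
[X], and keep the sets of which the selected ones are preimages.
Surjectivity of [g] guarantees both that a proper subset of [f(X)] has a proper
preimage and that the sets kept cover [f(X)]. *)

(** * Covers relative to a bornology with a compact base *)

Section compact_base_covers.
Context {R : realType} {Z : metricType R}.
Implicit Types (B K U : set Z) (BB : set (set Z)).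

Lemma subset_enlargement B (delta : R) :
  (0 < delta)%R -> B `<=` enlargement B delta.
Proof. by move=> delta0 x Bx; exists x => //=; rewrite mdistxx. Qed.

Lemma enlargementS B B' (delta : R) :
  B `<=` B' -> enlargement B delta `<=` enlargement B' delta.
Proof. by move=> BB' y [x /BB' B'x xy]; exists x. Qed.

(** The radius at which balls fit in [U] is locally bounded below by the
triangle inequality; compactness makes the bound uniform. *)
Lemma compact_enlargement_subset {K U} : compact K -> open U -> K `<=` U ->
  exists2 delta : R, (0 < delta)%R & enlargement K delta `<=` U.
Proof.
move=> /compact_near_coveringP cK oU KU.
have : \forall d \near (0%R : R)^'+, K `<=` [set x | ball x d `<=` U].
  apply: (cK R _ (fun d x => ball x d `<=` U)) => x /KU Ux.
  have /nbhs_ballP[e /= e0 xeU] : nbhs x U by exact: open_nbhs_nbhs.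
  (* Balls of radius below [e / 2] centred within [e / 2] of [x] lie in the
     ball of radius [e] around [x]. *)
  exists (ball x (e / 2)%R, [set d | d < e / 2]%R).
    split; first by apply: nbhsx_ballx; rewrite divr_gt0.
    by apply: nbhs_right_lt; rewrite divr_gt0.
  move=> [x' d] [/= xx' de] y x'y; apply: xeU.
  by apply: ball_split xx' _; apply: le_ball x'y; exact: ltW.
move=> KF; near (0%R : R)^'+ => d.
exists d => // y [x Kx xy].
have : K `<=` [set x | ball x d `<=` U] by near: d.
by move=> /(_ x Kx); apply; rewrite ballEmdist.
Unshelve. all: by end_near. Qed.

Context {BB BB0 : set (set Z)} (BB0P : is_compact_base BB BB0).

Lemma open_Bs_coversP {UU} : open_Bs_covers BB UU <->
  open_cover UU /\ forall B, BB B -> exists2 U, UU U & B `<=` U.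
Proof.
have [BB0BB BBsub cBB0] := BB0P.
split=> -[ocU UUB]; split=> // B BBB.
  have [U [delta [UUU delta0 BU]]] := UUB B BBB.
  by exists U => //; apply: subset_trans BU; exact: subset_enlargement.
have [B0 BB0B0 BB0s] := BBsub B BBB.
have [U UUU B0U] := UUB B0 (BB0BB _ BB0B0).
have [opU _ _] := ocU.
have [d d0 dU] := compact_enlargement_subset (cBB0 _ BB0B0) (opU _ UUU) B0U.
by exists U, d; split=> //; apply: subset_trans dU; exact: enlargementS.
Qed.

Lemma gamma_Bs_coversP {I} {U : nat -> set Z} : is_ideal I -> gamma_Bs_covers I BB U <->
  open_cover (range U) /\ forall B, BB B -> I [set n | ~ B `<=` U n].
Proof.
move=> [Isub _ _ _]; have [BB0BB BBsub cBB0] := BB0P.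
split=> -[ocU UB]; split=> // B BBB.
  have [delta [delta0 IB]] := UB B BBB.
  apply: Isub IB => n /= nBU BU; apply: nBU.
  by apply: subset_trans BU; exact: subset_enlargement.
have [B0 BB0B0 BB0s] := BBsub B BBB.
have [opU _ _] := ocU.
(* Where [B0] is not included in [U n], any radius will do. *)
have radius n : exists d : R,
    (0 < d)%R /\ (B0 `<=` U n -> enlargement B0 d `<=` U n).
  have [B0U|nB0U] := pselect (B0 `<=` U n); last by exists 1%R.
  have oUn : open (U n) by apply: opU; exists n.
  have [d d0 dU] := compact_enlargement_subset (cBB0 _ BB0B0) oUn B0U.
  by exists d.
have [delta deltaP] := choice radius.
exists delta; split=> [n|]; first by have [] := deltaP n.
apply: Isub (UB B0 (BB0BB _ BB0B0)) => n /= nBU B0U; apply: nBU.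
have [_ /(_ B0U)] := deltaP n.
by apply: subset_trans; exact: enlargementS.
Qed.

End compact_base_covers.

(** * Transport along a continuous surjection *)

Section surjection.
Context {R : realType} {X Z : metricType R} {g : X -> Z}.
Hypotheses (g_cont : continuous g) (g_surj : forall z, exists x, g x = z).

Lemma surjection_preimage_subset (U V : set Z) :
  g @^-1` U `<=` g @^-1` V -> U `<=` V.
Proof. by move=> UV z; have [x <-] := g_surj z; exact: UV. Qed.

Lemma open_cover_preimage UU :
  open_cover UU -> open_cover (preimage g @` UU).
Proof.
move=> [opU covU nU]; split.
- by move=> _ [U UUU <-]; apply: open_comp => [x _|]; [exact: g_cont|exact: opU].
- apply/seteqP; split=> // x _.
  have [U UUU Ugx] : (\bigcup_(U in UU) U) (g x) by rewrite covU.
  by exists (g @^-1` U) => //; exists U.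
- move=> [U UUU gUT]; apply: nU; rewrite -(_ : U = setT)//.
  by apply/seteqP; split=> //; apply: surjection_preimage_subset; rewrite gUT.
Qed.

Lemma open_cover_of_preimage (b : nat -> set Z) : (forall n, open (b n)) ->
  open_cover (range (fun n => g @^-1` b n)) -> open_cover (range b).
Proof.
move=> opb [_ covb nb]; split.
- by move=> _ [n _ <-].
- apply/seteqP; split=> // z _; have [x <-] := g_surj z.
  have [_ [n _ <-] bgx] : (\bigcup_(U in range (fun n => g @^-1` b n)) U) x.
    by rewrite covb.
  by exists (b n) => //; exists n.
- by move=> [n _ bnT]; apply: nb; exists n => //; rewrite bnT preimage_setT.
Qed.

(** The sets kept in [Z] are members of the original covers, hence open: this
is why the target class need only be reflected for sequences of open sets. *)
Lemma S1_surjection (A : set (set (set X))) (A' : set (set (set Z)))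
    (C : set (nat -> set X)) (C' : set (nat -> set Z)) :
  (forall UU, A' UU -> A (preimage g @` UU)) ->
  (forall UU U, A' UU -> UU U -> open U) ->
  (forall b, (forall n, open (b n)) -> C (fun n => g @^-1` b n) -> C' b) ->
  S1 A C -> S1 A' C'.
Proof.
move=> A'A A'open CC' S1AC UU A'UU.
have [a [UUa Ca]] := S1AC _ (fun n => A'A _ (A'UU n)).
have kept n : exists U, UU n U /\ g @^-1` U = a n.
  by have [U UUU Ua] := UUa n; exists U.
have [b bP] := choice kept.
exists b; split=> [n|]; first by have [] := bP n.
apply: CC' => [n|].
  by have [UUb _] := bP n; apply: A'open UUb; exact: A'UU.
by rewrite (_ : (fun n => _) = a)//; apply/funext => n; have [] := bP n.
Qed.

Context {BB BB0 : set (set X)} (BB0P : is_compact_base BB BB0).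

Let gBB : set (set Z) := [set g @` B | B in BB].

Lemma compact_base_image : is_compact_base gBB [set g @` B | B in BB0].
Proof.
have [BB0BB BBsub cBB0] := BB0P; split.
- by move=> _ [B /BB0BB BBB <-]; exists B.
- move=> _ [B BBB <-]; have [B0 BB0B0 BB0s] := BBsub B BBB.
  by exists (g @` B0); [exists B0|exact: image_subset].
- move=> _ [B /cBB0 cB <-]; apply: continuous_compact => //.
  exact: continuous_subspaceT.
Qed.

Lemma open_Bs_covers_preimage UU :
  open_Bs_covers gBB UU -> open_Bs_covers BB (preimage g @` UU).
Proof.
move=> /(open_Bs_coversP compact_base_image)[ocU UUB].
apply/(open_Bs_coversP BB0P); split; first exact: open_cover_preimage.
move=> B BBB.
have [U UUU gBU] : exists2 U, UU U & g @` B `<=` U by apply: UUB; exists B.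
by exists (g @^-1` U); [exists U|rewrite -image_sub].
Qed.

Lemma gamma_Bs_covers_preimage I U : is_ideal I ->
  gamma_Bs_covers I gBB U -> gamma_Bs_covers I BB (fun n => g @^-1` U n).
Proof.
move=> hI /(gamma_Bs_coversP compact_base_image hI)[ocU UB].
apply/(gamma_Bs_coversP BB0P) => //; split.
  by rewrite -(image_comp U (preimage g)); exact: open_cover_preimage.
move=> B BBB; have [Isub _ _ _] := hI.
have IB : I [set n | ~ g @` B `<=` U n] by apply: UB; exists B.
by apply: Isub IB => n /=; rewrite image_sub.
Qed.

Lemma gamma_Bs_covers_of_preimage J b : is_ideal J -> (forall n, open (b n)) ->
  gamma_Bs_covers J BB (fun n => g @^-1` b n) -> gamma_Bs_covers J gBB b.
Proof.
move=> hJ opb /(gamma_Bs_coversP BB0P hJ)[ocb bB].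
apply/(gamma_Bs_coversP compact_base_image) => //.
split; first exact: open_cover_of_preimage.
move=> _ [B BBB <-]; have [Jsub _ _ _] := hJ.
by apply: Jsub (bB B BBB) => n /=; rewrite image_sub.
Qed.

Lemma S1_gamma_surjection I J : is_ideal I -> is_ideal J ->
  S1 (families (gamma_Bs_covers I BB)) (gamma_Bs_covers J BB) ->
  S1 (families (gamma_Bs_covers I gBB)) (gamma_Bs_covers J gBB).
Proof.
move=> hI hJ; apply: S1_surjection.
- move=> _ [U gU <-]; exists (fun n => g @^-1` U n).
    exact: gamma_Bs_covers_preimage.
  by rewrite -(image_comp U (preimage g)).
- by move=> _ V [U [[opU _ _] _] <-]; exact: opU.
- by move=> b; exact: gamma_Bs_covers_of_preimage.
Qed.

Lemma S1_open_surjection J : is_ideal J ->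
  S1 (open_Bs_covers BB) (gamma_Bs_covers J BB) ->
  S1 (open_Bs_covers gBB) (gamma_Bs_covers J gBB).
Proof.
move=> hJ; apply: S1_surjection.
- exact: open_Bs_covers_preimage.
- by move=> UU U [[opU _ _] _]; exact: opU.
- by move=> b; exact: gamma_Bs_covers_of_preimage.
Qed.

End surjection.

(** * Corestriction of a map to its range *)

Definition to_range {X Y : Type} (f : X -> Y) (x : X) : range f :=
  SigSub (mem_set (imageT f x)).

Lemma to_range_surj {X Y : Type} (f : X -> Y) (z : range f) :
  exists x, to_range f x = z.
Proof.
by have [x _ fx] := set_mem (valP z); exists x; exact: val_inj.
Qed.

Lemma continuous_to_range {R : realType} {X Y : metricType R} (f : X -> Y) :
  continuous f -> continuous (to_range f).
Proof. by move=> cf; apply: continuous_comp_initial. Qed.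

Lemma image_bornologyE {X Y : Type} (f : X -> Y) (BB : set (set X)) :
  image_bornology f BB = [set to_range f @` B | B in BB].
Proof.
apply: eq_imagel => B _; apply/seteqP; split=> [z [x Bx fx]|_ [x Bx <-]].
  by exists x => //; exact: val_inj.
by exists x.
Qed.

Theorem proposition3p1 (R : realType) (X Y : metricType R)
    (infX : infinite_set [set: X])
    (BB BB0 : set (set X)) (hBB : is_bornology BB)
    (hBB0 : is_compact_base BB BB0)
    (I J : set (set nat)) (hI : is_ideal I) (hJ : is_ideal J)
    (f : X -> Y) (cf : continuous f) :
  (S1 (families (gamma_Bs_covers I BB)) (gamma_Bs_covers J BB) ->
   S1 (families (gamma_Bs_covers I (image_bornology f BB)))
      (gamma_Bs_covers J (image_bornology f BB)))
  /\
  (S1 (open_Bs_covers BB) (gamma_Bs_covers J BB) ->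
   S1 (open_Bs_covers (image_bornology f BB))
      (gamma_Bs_covers J (image_bornology f BB))).
Proof.
have g_cont := continuous_to_range f cf.
have g_surj := to_range_surj f.
rewrite image_bornologyE; split.
  exact: (S1_gamma_surjection g_cont g_surj hBB0).
exact: (S1_open_surjection g_cont g_surj hBB0).
Qed.
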